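(* Let $\tilde X$ be a (finite, possibly unordered) simplicial complex, $X:=\mathrm{sd}\,\tilde X$ its subdivision, $(E,\nabla)\to X$ a discrete vector bundle with connection, and $(\tilde E,\tilde\nabla)\to\tilde X$ the associated coarsened vector bundle with connection. Then the coarsening map commutes with the exterior covariant derivative: $d_{\tilde\nabla}\,\mathfrak{C}=\mathfrak{C}\,d_\nabla$ as maps $C^k(X;E)\to\tilde C^{k+1}(\tilde X;\tilde E)$ for all $k\ge 0$.
   Context: Subdivision: $X=\mathrm{sd}\,\tilde X$ has one vertex $c(\tilde\sigma)$ for each simplex $\tilde\sigma$ of $\tilde X$, and its simplices are the sets $\{c(\tau_0),\dots,c(\tau_m)\}$ with $\tau_0\supsetneq\tau_1\supsetneq\dots\supsetneq\tau_m$ simplices of $\tilde X$. It is locally ordered by decreasing dimension, so such a simplex is written $[c(\tau_0),\dots,c(\tau_m)]$ with lowest (origin) vertex $c(\tau_0)$. In particular, for a $k$-simplex $\tilde\sigma^k$ of $\tilde X$, every $k$-simplex of $\mathrm{sd}\,\tilde\sigma^k$ has origin vertex $c(\tilde\sigma^k)$. Superscripts denote dimension and $\prec$ denotes ''is a proper face of''. A discrete vector bundle with connection $(E,\nabla)$ over $X$ consists of a finite-dimensional (real or complex) vector space $E_i$ for each vertex $i$ of $X$ and an invertible linear map $U_{ji}\colon E_i\to E_j$ for each edge $\{i,j\}$ with $U_{ij}=U_{ji}^{-1}$. $C^k(X;E)$ is the space of $\alpha$ assigning to each $k$-simplex $[v_0,\dots,v_k]$ (in increasing order) a vector in $E_{v_0}$,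 extended alternatingly to other vertex orderings, and $$\langle d_\nabla\alpha,[v_0,\dots,v_{k+1}]\rangle=U_{v_0v_1}\langle\alpha,[v_1,\dots,v_{k+1}]\rangle+\sum_{i=1}^{k+1}(-1)^i\langle\alpha,[v_0,\dots,\hat v_i,\dots,v_{k+1}]\rangle .$$ Coarsened bundle: $(\tilde E,\tilde\nabla)\to\tilde X$ has fibers $\tilde E_{c(\tilde\sigma)}=E_{c(\tilde\sigma)}$ for $\tilde\sigma\in\tilde X$ and parallel transport maps $U_{c(\tilde\sigma^k),c(\tilde\sigma^{k+1})}$ (and their inverses) for all $\tilde\sigma^k\prec\tilde\sigma^{k+1}$ in $\tilde X$. Coarse cochains $\tilde\alpha\in\tilde C^k(\tilde X;\tilde E)$ assign to each oriented $k$-simplex $\tilde\sigma$ of $\tilde X$ a vector $\langle\tilde\alpha,\tilde\sigma\rangle\in\tilde E_{c(\tilde\sigma)}$, changing sign when the orientation is reversed. Relative orientations $o(\cdot,\cdot)\in\{\pm1\}$: all simplices of $\tilde X$ are given some orientation, and simplices of $X$ are oriented by their vertex order. For a codimension-one face, $o([v_0,\dots,\hat v_i,\dots,v_{k+1}],[v_0,\dots,v_{k+1}])=(-1)^i$, the sign being reversed when the orientation of either simplex is reversed. For a $k$-simplex $\sigma^k$ of $\mathrm{sd}\,\tilde\sigma^k$, $o(\sigma^k,\tilde\sigma^k)$ is $+1$ if their orientations agree (viewing $\mathrm{sd}\,\tilde\sigma^k$ as a barycentric subdivision in the affine span of $\tilde\sigma^k$) and $-1$ otherwise; combinatorially, if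 $\sigma^k=[c(\tau^k),\dots,c(\tau^0)]$ with $\tau^k=\tilde\sigma^k$, $\tau^0=\{v_0\}$ and $\tau^i\setminus\tau^{i-1}=\{v_i\}$, then $o(\sigma^k,\tilde\sigma^k)=(-1)^{k(k+1)/2}$ times the sign comparing $[v_0,\dots,v_k]$ with the orientation of $\tilde\sigma^k$. The cochain coarsening map $\mathfrak{C}\colon C^k(X;E)\to\tilde C^k(\tilde X;\tilde E)$ is $$\langle\mathfrak{C}(\alpha),\tilde\sigma^k\rangle=\sum_{\sigma^k\in\mathrm{sd}\,\tilde\sigma^k}o(\sigma^k,\tilde\sigma^k)\,\langle\alpha,\sigma^k\rangle\in E_{c(\tilde\sigma^k)},$$ the sum being over the $k$-simplices of $\mathrm{sd}\,\tilde\sigma^k$. The coarse discrete exterior covariant derivative $d_{\tilde\nabla}\colon\tilde C^k(\tilde X;\tilde E)\to\tilde C^{k+1}(\tilde X;\tilde E)$ is $$\langle d_{\tilde\nabla}\tilde\alpha,\tilde\sigma^{k+1}\rangle=\sum_{\tilde\sigma^k\prec\tilde\sigma^{k+1}}o(\tilde\sigma^k,\tilde\sigma^{k+1})\,U_{c(\tilde\sigma^{k+1}),c(\tilde\sigma^k)}\,\langle\tilde\alpha,\tilde\sigma^k\rangle .$$ *)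

(* Defs.v *)
From HB Require Import structures.
From mathcomp Require Import all_boot all_order all_fingroup all_algebra.

Set Implicit Arguments.
Unset Strict Implicit.
Unset Printing Implicit Defensive.

Import GRing.Theory.
Local Open Scope ring_scope.

Record scomplex (V : finType) := SComplex {
  simplices :> {set {set V}};
  simplex_neq0 : set0 \notin simplices;
  simplex_vertex : forall v, [set v] \in simplices;
  simplex_face : forall s t : {set V},
    s \in simplices -> t \subset s -> t != set0 -> t \in simplices }.

Definition simplex (V : finType) (X : scomplex V) := {s : {set V} | s \in X}.

Definition ksimplex (V : finType) (X : scomplex V) (k : nat) :=
  {s : {set V} | (s \in X) && (#|s| == k.+1)}.

(* The relation [lo_lt] is only meaningful between vertices of a common
   simplex: it restricts to a strict total order on each simplex. *)
Record lo_complex (V : finType) := LOComplex {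
  lo_base :> scomplex V;
  lo_lt : rel V;
  lo_irr : irreflexive lo_lt;
  lo_trans : forall s, s \in lo_base -> {in s & &, transitive lo_lt};
  lo_total : forall s, s \in lo_base ->
    {in s &, forall u v, u != v -> lo_lt u v || lo_lt v u} }.

(* [osimplex X k v0] is the type of the k-simplices [v_0, ..., v_k], written in
   increasing order, whose origin is v0; the tuple is (v_1, ..., v_k).  Making
   the origin an index lets cochains take values in the fiber over it. *)
Definition is_osimplex (V : finType) (X : lo_complex V) (l : seq V) :=
  ([set x in l] \in X) && pairwise (lo_lt X) l.

Definition osimplex (V : finType) (X : lo_complex V) (k : nat) (v0 : V) :=
  {t : k.-tuple V | is_osimplex X (v0 :: t)}.

Lemma is_osimplex_sub V (X : lo_complex V) (l l' : seq V) :
  subseq l' l -> l' != [::] -> is_osimplex X l -> is_osimplex X l'.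
Proof.
move=> sl' nz /andP[lX lt_l]; apply/andP; split; last exact: subseq_pairwise lt_l.
apply: simplex_face lX _ _.
  by apply/subsetP => x; rewrite !inE; apply: mem_subseq.
case: l' nz {sl'} => // x l' _; apply/set0Pn; exists x.
by rewrite !inE eqxx.
Qed.

Definition tdel (T : Type) (n : nat) (t : n.+1.-tuple T) (i : 'I_n.+1) :
  n.-tuple T := [tuple tnth t (lift i j) | j < n].

Lemma tdelE (T : Type) n (t : n.+1.-tuple T) (i : 'I_n.+1) :
  tdel t i = take i t ++ drop i.+1 t :> seq T.
Proof.
have x0 : T := tnth t ord0.
have szt : size (take i t) = i by rewrite size_take size_tuple ltn_ord.
apply: (@eq_from_nth _ x0).
  by rewrite size_tuple size_cat szt size_drop size_tuple subSS subnKC ?leq_ord.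
move=> j; rewrite size_tuple => ltj.
rewrite -[j]/(val (Ordinal ltj)) -tnth_nth tnth_mktuple (tnth_nth x0) /=.
rewrite nth_cat szt /bump; case: ltnP => [ltji|leij] /=.
  by rewrite add0n nth_take.
by rewrite nth_drop add1n [(i.+1 + _)%N]addSn subnKC.
Qed.

Lemma tdel_subseq (T : eqType) n (t : n.+1.-tuple T) (i : 'I_n.+1) :
  subseq (tdel t i) t.
Proof.
rewrite tdelE -{3}[tval t](cat_take_drop i) cat_subseq //.
by rewrite -addn1 addnC -drop_drop; apply: drop_subseq.
Qed.

Section Faces.
Variables (V : finType) (X : lo_complex V) (k : nat) (v0 : V).
Variable s : osimplex X k.+1 v0.

Lemma face0_subproof : is_osimplex X (thead (val s) :: behead_tuple (val s)).
Proof.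
have := valP s; case/tupleP: (val s) => x t /=; rewrite theadE.
by apply: is_osimplex_sub => //; apply: subseq_cons.
Qed.

Lemma faceS_subproof i : is_osimplex X (v0 :: tdel (val s) i).
Proof.
by apply: is_osimplex_sub (valP s) => //=; rewrite eqxx tdel_subseq.
Qed.

(* [v_1, ..., v_{k+1}] *)
Definition face0 : osimplex X k (thead (val s)) :=
  exist _ (behead_tuple (val s)) face0_subproof.
(* [v_0, ..., v_{k+1}] without its vertex of index i + 1 *)
Definition faceS (i : 'I_k.+1) : osimplex X k v0 :=
  exist _ (tdel (val s) i) (faceS_subproof i).

End Faces.

(* [tr j i] is U_{ji} : E_i -> E_j; its values are unconstrained, and never
   used, when {i, j} is not an edge. *)
Record bundle (K : fieldType) (V : finType) (X : scomplex V) := Bundle {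
  fib : V -> vectType K;
  tr : forall j i : V, 'Hom(fib i, fib j);
  trK : forall i j : V, i != j -> [set i; j] \in X ->
    (tr i j \o tr j i)%VF = \1%VF }.

Definition cochain (K : fieldType) (V : finType) (X : lo_complex V)
    (E : bundle K X) (k : nat) :=
  forall v0 : V, osimplex X k v0 -> fib E v0.

Definition d_nabla (K : fieldType) (V : finType) (X : lo_complex V)
    (E : bundle K X) (k : nat) (a : cochain E k) : cochain E k.+1 :=
  fun v0 s =>
    tr E v0 (thead (val s)) (a _ (face0 s))
      + \sum_(i < k.+1) (-1) ^+ i.+1 *: a v0 (faceS s i).

Section Subdivision.
Variables (V : finType) (X : scomplex V).

Definition sd_simplices : {set {set simplex X}} :=
  [set S : {set simplex X} | (S != set0) &&
    [forall a : simplex X in S, forall b : simplex X in S,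
      (val a \subset val b) || (val b \subset val a)]].

Lemma sd_simplicesP (S : {set simplex X}) :
  reflect (S != set0 /\
           {in S &, forall a b : simplex X, (val a \subset val b) || (val b \subset val a)})
          (S \in sd_simplices).
Proof.
rewrite inE; apply: (iffP andP) => -[nS cS]; split=> //.
  by move=> a b aS bS; move/forall_inP/(_ a aS)/forall_inP: cS; apply.
by apply/forall_inP => a aS; apply/forall_inP => b; apply: cS.
Qed.

Fact sd_neq0 : set0 \notin sd_simplices.
Proof. by rewrite inE eqxx. Qed.

Fact sd_vertex a : [set a] \in sd_simplices.
Proof.
apply/sd_simplicesP; split; first by apply/set0Pn; exists a; rewrite inE.
by move=> b c; rewrite !inE => /eqP-> /eqP->; rewrite subxx.
Qed.

Fact sd_face (s t : {set simplex X}) :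
  s \in sd_simplices -> t \subset s -> t != set0 -> t \in sd_simplices.
Proof.
move=> /sd_simplicesP[_ cs] /subsetP ts nt; apply/sd_simplicesP; split=> //.
by move=> a b /ts aS /ts bS; apply: cs.
Qed.

Definition sd_complex := SComplex sd_neq0 sd_vertex sd_face.

Definition sd_lt : rel (simplex X) := fun a b => (#|val b| < #|val a|)%N.

Fact sd_irr : irreflexive sd_lt.
Proof. by move=> a; rewrite /sd_lt ltnn. Qed.

Fact sd_trans s : s \in sd_complex -> {in s & &, transitive sd_lt}.
Proof.
by move=> _ b a c _ _ _; rewrite /sd_lt => lba lcb; apply: ltn_trans lba.
Qed.

Fact sd_total s : s \in sd_complex ->
  {in s &, forall u v : simplex X, u != v -> sd_lt u v || sd_lt v u}.
Proof.
move=> /sd_simplicesP[_ cs] a b aS bS neq_ab; rewrite /sd_lt -neq_ltn eq_sym.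
apply: contra neq_ab => /eqP eq_card; rewrite -val_eqE.
by case/orP: (cs a b aS bS) => sub; [|rewrite eq_sym];
  rewrite eqEcard sub eq_card leqnn.
Qed.

Definition sd : lo_complex (simplex X) := LOComplex sd_irr sd_trans sd_total.

End Subdivision.

(* An orientation of a k-simplex s is the function sending an ordering of the
   vertices of s to the sign comparing it with the orientation (and the other
   tuples to 0); 0-simplices have two orientations as well. *)
Definition is_orientation (V : finType) (X : scomplex V) (k : nat)
    (s : ksimplex X k) (e : {ffun k.+1.-tuple V -> int}) :=
  [forall t : k.+1.-tuple V, e t ^+ 2 == ([set x in t] == val s)%:R] &&
  [forall t : k.+1.-tuple V, forall p : 'S_k.+1,
     e [tuple tnth t (p i) | i < k.+1] == (-1) ^+ p * e t].

Record orientation (V : finType) (X : scomplex V) (k : nat)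
    (s : ksimplex X k) := Orientation {
  osign :> {ffun k.+1.-tuple V -> int};
  osignP : is_orientation s osign }.
HB.instance Definition _ V (X : scomplex V) k (s : ksimplex X k) :=
  [isSub for @osign V X k s].

Section Orientations.
Variables (V : finType) (X : scomplex V).

Section OneSimplex.
Variables (k : nat) (s : ksimplex X k) (e : orientation s).

Lemma osign_sqr t : e t ^+ 2 = ([set x in t] == val s)%:R.
Proof. by case/andP: (osignP e) => /forallP/(_ t)/eqP. Qed.

Lemma osign_perm t (p : 'S_k.+1) :
  e [tuple tnth t (p i) | i < k.+1] = (-1) ^+ p * e t.
Proof. by case/andP: (osignP e) => _ /forallP/(_ t)/forallP/(_ p)/eqP. Qed.

Lemma osign_neq0 t : (e t != 0) = ([set x in t] == val s).
Proof. by rewrite -sqrf_eq0 osign_sqr; case: (_ == val s). Qed.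

Lemma oopp_subproof : is_orientation s [ffun t => - e t].
Proof.
apply/andP; split; apply/forallP => t; first by rewrite ffunE sqrrN osign_sqr.
by apply/forallP => p; rewrite !ffunE osign_perm mulrN.
Qed.

Definition oopp : orientation s := Orientation oopp_subproof.

Lemma ooppE t : oopp t = - e t. Proof. by rewrite ffunE. Qed.

End OneSimplex.

(* The condition says that w is an ordering of s' whose i-th omission is an
   ordering of s; the value depends on neither w nor i (see [rel_orientE]). *)
Definition rel_orient (k : nat) (s : ksimplex X k) (s' : ksimplex X k.+1)
    (e : orientation s) (e' : orientation s') : int :=
  if [pick wi : k.+2.-tuple V * 'I_k.+2 |
       ([set x in wi.1] == val s') && ([set x in tdel wi.1 wi.2] == val s)]
  is Some (w, i) then (-1) ^+ i * e (tdel w i) * e' w else 0.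

Lemma rel_orientN k (s : ksimplex X k) (s' : ksimplex X k.+1)
    (e : orientation s) (e' : orientation s') :
  rel_orient e (oopp e') = - rel_orient e e'.
Proof.
rewrite /rel_orient; case: pickP => [[w i] _|_]; last by rewrite oppr0.
by rewrite ooppE mulrN.
Qed.

Lemma ksimplex_ordering_uniq k (s : ksimplex X k) (t : k.+1.-tuple V) :
  [set x in t] = val s -> uniq t.
Proof.
move=> ts; apply/card_uniqP; rewrite size_tuple -[RHS](eqP (andP (valP s)).2).
by rewrite -ts cardsE.
Qed.

Lemma rel_orientE k (s : ksimplex X k) (s' : ksimplex X k.+1)
    (e : orientation s) (e' : orientation s') w (i : 'I_k.+2) :
  [set x in w] = val s' -> [set x in tdel w i] = val s ->
  rel_orient e e' = (-1) ^+ i * e (tdel w i) * e' w.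
Proof.
move=> ws' ws; rewrite /rel_orient; case: pickP => [[w' i']|/(_ (w, i))] /=;
  last by rewrite ws' ws !eqxx.
case/andP=> /eqP ws2' /eqP ws2.
have uw := ksimplex_ordering_uniq ws'; have uw' := ksimplex_ordering_uniq ws2'.
have eqm : perm_eq w' w.
  rewrite uniq_perm // => x.
  by have /setP/(_ x) := etrans ws2' (esym ws'); rewrite !inE.
have /tuple_permP[p /val_inj def_w'] := eqm.
have mis (v : k.+2.-tuple V) j : uniq v -> tnth v j \notin tdel v j.
  move=> uv; apply/tnthP => -[l]; rewrite tnth_mktuple => /(tuple_uniqP _ uv)/eqP.
  by rewrite (negPf (neq_lift _ _)).
have pi' : p i' = i.
  apply/eqP; rewrite -[_ == _]negbK; apply/negP => neq.
  have := mis _ i' uw'; rewrite {1}def_w' tnth_mktuple.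
  have : tnth w (p i') \in tdel w i.
    case: (unliftP i (p i')) neq => [j -> _|->]; last by rewrite eqxx.
    by apply/tnthP; exists j; rewrite tnth_mktuple.
  have /setP/(_ (tnth w (p i'))) := etrans ws (esym ws2).
  by rewrite !inE => -> ->.
have [q def_p] : exists q : 'S_k.+1, p = lift_perm i' i q.
  pose f j := odflt j (unlift i (p (lift i' j))).
  have fE j : lift i (f j) = p (lift i' j).
    rewrite /f; case: unliftP => //= eq_i; exfalso; move: eq_i.
    by rewrite -pi' => /perm_inj/eqP; rewrite eq_sym (negPf (neq_lift _ _)).
  have finj : injective f.
    move=> j l eqf; have := fE j; rewrite eqf fE => /perm_inj.
    by move/lift_inj.
  exists (perm finj); apply/permP => j; case: (unliftP i' j) => [l ->|->].
    by rewrite lift_perm_lift permE fE.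
  by rewrite lift_perm_id.
have -> : tdel w' i' = [tuple tnth (tdel w i) (q j) | j < k.+1].
  apply: eq_from_tnth => j; rewrite !tnth_mktuple def_w' tnth_mktuple.
  by rewrite def_p lift_perm_lift.
rewrite osign_perm def_w' osign_perm def_p odd_lift_perm.
rewrite -(signr_odd _ i') -(signr_odd _ i).
by case: (odd_perm q) (odd i') (odd i) => [] [] [];
  rewrite /= ?(expr0, expr1, mul1r, mulN1r, mulrN, mulNr, opprK).
Qed.

End Orientations.

Definition center (V : finType) (X : scomplex V) (k : nat) (s : ksimplex X k) :
  simplex X := exist _ (val s) (proj1 (andP (valP s))).

(* Bundles with connection over an unordered complex: fibers are attached to
   all simplices, and transport is along codimension-one incidences only. *)
Record coarse_bundle (K : fieldType) (V : finType) (X : scomplex V) :=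
  CoarseBundle {
    cfib : simplex X -> vectType K;
    ctr : forall b a : simplex X, 'Hom(cfib a, cfib b);
    ctrK : forall a b : simplex X,
      val a \subset val b -> #|val b| = #|val a|.+1 ->
      (ctr a b \o ctr b a)%VF = \1%VF /\ (ctr b a \o ctr a b)%VF = \1%VF }.

Section Coarsening.
Variables (K : fieldType) (V : finType) (X : scomplex V).

Section CoarsenBundle.
Variable E : bundle K (sd X).

Fact coarsen_trK (a b : simplex X) :
  val a \subset val b -> #|val b| = #|val a|.+1 ->
  (tr E a b \o tr E b a)%VF = \1%VF /\ (tr E b a \o tr E a b)%VF = \1%VF.
Proof.
move=> sab card_b; have neq_ab : a != b.
  by apply/eqP => eq_ab; move/eqP: card_b; rewrite eq_ab (ltn_eqF (ltnSn _)).
have edge : [set a; b] \in sd X.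
  apply/sd_simplicesP; split; first by apply/set0Pn; exists a; rewrite set21.
  by move=> c d; rewrite !inE => /orP[]/eqP-> /orP[]/eqP->;
    rewrite ?subxx ?sab ?orbT.
by split; apply: trK => //; rewrite 1?eq_sym // setUC.
Qed.

Definition coarsen_bundle : coarse_bundle K X := CoarseBundle coarsen_trK.

End CoarsenBundle.

Record ccochain (E : coarse_bundle K X) (k : nat) := CCochain {
  cval :> forall s : ksimplex X k, orientation s -> cfib E (center s);
  cval_opp : forall (s : ksimplex X k) (e : orientation s),
    @cval s (oopp e) = - @cval s e }.

Section CoarseDerivative.
Variables (E : coarse_bundle K X) (k : nat).
Variable ori : forall s : ksimplex X k, orientation s.
Variable a : ccochain E k.

Definition d_coarse_val (s' : ksimplex X k.+1) (e' : orientation s') :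
    cfib E (center s') :=
  \sum_(s : ksimplex X k | val s \proper val s')
    ctr E (center s') (center s) (a s (ori s)) *~ rel_orient (ori s) e'.

Fact d_coarse_opp s' (e' : orientation s') :
  d_coarse_val (oopp e') = - d_coarse_val e'.
Proof.
by rewrite -sumrN; apply: eq_bigr => s _; rewrite rel_orientN mulrNz.
Qed.

Definition d_coarse : ccochain E k.+1 := CCochain d_coarse_opp.

End CoarseDerivative.

Section Flags.
Variable k : nat.

(* For the simplex [c(tau^k), ..., c(tau^0)] of sd X with tau^k = s, states
   that tau^i \ tau^{i-1} = {w_i} for all i, with tau^{-1} empty. *)
Definition flag_ordering (s : ksimplex X k) (t : osimplex (sd X) k (center s))
    (w : k.+1.-tuple V) :=
  let tau := rev [seq val b | b : simplex X <- center s :: val t] in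
  [forall i : 'I_k.+1,
    nth set0 tau i :\: nth set0 (set0 :: tau) i == [set tnth w i]].

Lemma sd_chain (l : seq (simplex X)) : is_osimplex (sd X) l ->
  {in l &, forall a b : simplex X,
    (val a \subset val b) || (val b \subset val a)}.
Proof.
by case/andP => /sd_simplicesP[_ cl] _ a b al bl; apply: cl; rewrite inE.
Qed.

Lemma sd_pairwise_size (b : simplex X) (l : seq (simplex X)) :
  pairwise (@sd_lt V X) (b :: l) -> (size l < #|val b|)%N.
Proof.
elim: l b => [|c l IHl] b /=.
  by move=> _; rewrite card_gt0; apply: contraNneq (simplex_neq0 X) => <-; apply: valP.
by case/andP => /andP[lt_cb _] /IHl lt_l; apply: leq_trans lt_cb.
Qed.

(* A k-simplex of sd X lies in sd s, for a k-simplex s, iff its origin is c(s). *)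
Lemma sd_originP (s : ksimplex X k) b (t : k.-tuple (simplex X)) :
  is_osimplex (sd X) (b :: t) ->
  all (fun c : simplex X => val c \subset val s) (b :: t) = (b == center s).
Proof.
move=> bt; have chain := sd_chain bt; have /andP[_ lt_t] := bt.
apply/idP/eqP => [/andP[sub_b _]|def_b].
  apply: val_inj; apply/eqP; rewrite /= eqEcard sub_b.
  rewrite (eqP (andP (valP s)).2) -[k in (k < _)%N](size_tuple t).
  exact: sd_pairwise_size.
apply/allP => c ct; rewrite -[val s]/(val (center s)) -def_b.
move: (ct); rewrite inE => /predU1P[-> //|c_t].
have /orP[//|sub_bc] := chain c b ct (mem_head b t).
move: lt_t => /= /andP[/allP/(_ c c_t)]; rewrite /sd_lt ltnNge.
by rewrite (subset_leq_card sub_bc).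
Qed.

Lemma sd_flag_card (b : simplex X) (l : seq (simplex X)) :
  pairwise (@sd_lt V X) (b :: l) -> #|val b| = (size l).+1 ->
  rev [seq #|val c| | c : simplex X <- b :: l] = iota 1 (size l).+1.
Proof.
elim: l b => [|c l IHl] b lt_l card_b; first by rewrite /= card_b.
have := lt_l; rewrite pairwise_cons => /andP[/andP[lt_cb _] lt_cl].
have card_c : #|val c| = (size l).+1.
  apply/eqP; rewrite eqn_leq sd_pairwise_size // andbT.
  by rewrite -ltnS; move: lt_cb; rewrite /sd_lt card_b.
rewrite map_cons rev_cons (IHl c lt_cl card_c) card_b.
by rewrite -cats1 -[[:: _]]/(iota (1 + (size l).+1) 1) -iotaD addn1.
Qed.

Lemma flag_orderingP (s : ksimplex X k) (t : osimplex (sd X) k (center s)) :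
  exists w : k.+1.-tuple V,
    [set x in w] = val s /\ forall w', flag_ordering t w' = (w' == w).
Proof.
set tau := rev [seq val b | b : simplex X <- center s :: val t].
have chain := sd_chain (valP t); have /andP[_ lt_t] := valP t.
have card_s : #|val s| = k.+1 := eqP (andP (valP s)).2.
have sz_tau : size tau = k.+1 by rewrite size_rev /= size_map size_tuple.
have card_tau i : (i < k.+1)%N -> #|nth set0 tau i| = i.+1.
  move=> lt_i.
  have : [seq #|A| | A : {set V} <- tau] = iota 1 k.+1.
    rewrite map_rev -map_comp.
    by have := sd_flag_card lt_t; rewrite size_tuple; apply.
  move/(congr1 (nth 0%N ^~ i)).
  by rewrite (nth_map set0) ?sz_tau // nth_iota.
have sub_tau i j : (i <= j < k.+1)%N -> nth set0 tau i \subset nth set0 tau j.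
  case/andP=> le_ij lt_j; have lt_i := leq_ltn_trans le_ij lt_j.
  have inT n : (n < k.+1)%N -> exists2 b, b \in center s :: val t
      & nth set0 tau n = val b.
    move=> lt_n; have : nth set0 tau n \in tau by rewrite mem_nth ?sz_tau.
    by rewrite mem_rev => /mapP.
  have [b b_t def_b] := inT i lt_i; have [c c_t def_c] := inT j lt_j.
  case/orP: (chain b c b_t c_t); rewrite -def_b -def_c // => sub.
  have /eqP -> // : nth set0 tau j == nth set0 tau i.
  by rewrite eqEcard sub !card_tau // ltnS.
have last_tau : nth set0 tau k = val s.
  apply/eqP; rewrite eqEcard card_tau // card_s leqnn andbT.
  have : nth set0 tau k \in tau by rewrite mem_nth ?sz_tau.
  rewrite mem_rev => /mapP[b b_t ->].
  have := sd_originP s (valP t); rewrite eqxx => /allP; exact.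
have sub_prev i : (i < k.+1)%N ->
    nth set0 (set0 :: tau) i \subset nth set0 tau i.
  by case: i => [|i] lt_i; rewrite ?sub0set ?sub_tau ?leqnSn.
have step (i : 'I_k.+1) : exists x,
    nth set0 tau i :\: nth set0 (set0 :: tau) i = [set x].
  apply/cards1P; rewrite cardsD (setIidPr (sub_prev i _)) // card_tau //.
  case: i => -[|i] lt_i /=; first by rewrite cards0.
  by rewrite card_tau ?subSnn // ltnW.
have [f fP] := fin_all_exists step; exists [tuple f i | i < k.+1].
have f_tau i : (f i \in nth set0 tau i) && (f i \notin nth set0 (set0 :: tau) i).
  by have /setP/(_ (f i)) := fP i; rewrite !inE eqxx andbC.
split; last first.
  move=> w'; apply/forallP/eqP => [fw|-> i]; last first.
    by rewrite tnth_mktuple fP.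
  apply: eq_from_tnth => i; rewrite tnth_mktuple; apply: set1_inj.
  by rewrite -fP; apply/esym/eqP/fw.
have f_inj : injective f.
  suff neq (i j : 'I_k.+1) : (i < j)%N -> f i != f j.
    move=> i j eq_f; apply: val_inj; case: (ltngtP i j) => // /neq.
      by rewrite eq_f eqxx.
    by rewrite eq_f eqxx.
  move=> lt_ij; apply: contraTneq (f_tau j) => eq_f; rewrite -eq_f negb_and negbK.
  have [fi_i _] := andP (f_tau i); apply/orP; right.
  case: j lt_ij {eq_f} => -[|j] lt_j //= lt_ij.
  by apply: (subsetP (sub_tau i j _)) fi_i; rewrite -ltnS lt_ij ltnW.
apply/eqP; rewrite eqEcard; apply/andP; split.
  apply/subsetP => x; rewrite inE => /tnthP[i ->]; rewrite tnth_mktuple -last_tau.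
  apply: (subsetP (sub_tau i k _)) => //; last by case/andP: (f_tau i).
  by rewrite -ltnS ltn_ord /=.
rewrite card_s cardsE (card_uniqP _) ?size_tuple //.
by rewrite map_inj_uniq ?enum_uniq.
Qed.

(* The pick always succeeds, with a unique solution (see [flag_orderingP]). *)
Definition flag_orient (s : ksimplex X k) (t : osimplex (sd X) k (center s))
    (e : orientation s) : int :=
  if [pick w | flag_ordering t w] is Some w
  then (-1) ^+ (k * k.+1)./2 * e w else 0.

Lemma flag_orientN s (t : osimplex (sd X) k (center s)) (e : orientation s) :
  flag_orient t (oopp e) = - flag_orient t e.
Proof.
rewrite /flag_orient; case: pickP => [w _|_]; last by rewrite oppr0.
by rewrite ooppE mulrN.
Qed.

End Flags.

Section CochainCoarsening.
Variables (E : bundle K (sd X)) (k : nat) (a : cochain E k).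

(* The k-simplices of sd s are exactly the k-simplices of sd X with origin
   c(s) (see [sd_originP]), so the sum ranges over the latter. *)
Definition coarsen_val (s : ksimplex X k) (e : orientation s) :
    cfib (coarsen_bundle E) (center s) :=
  \sum_(t : osimplex (sd X) k (center s)) a t *~ flag_orient t e.

Fact coarsen_opp s (e : orientation s) :
  coarsen_val (oopp e) = - coarsen_val e.
Proof.
by rewrite -sumrN; apply: eq_bigr => t _; rewrite flag_orientN mulrNz.
Qed.

Definition coarsen : ccochain (coarsen_bundle E) k := CCochain coarsen_opp.

End CochainCoarsening.

End Coarsening.

(* Main.v *)
Require Import Defs.
From mathcomp Require Import all_boot all_order all_fingroup all_algebra.

(** Write [w] for an ordering [(w_0, ..., w_k)] of the vertices of a [k]-simplex
    [s].  The [k]-simplices of [sd s] are the complete flags of [s], and those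
    correspond to the orderings of [s]: the flag of [w] consists of the centers
    of the initial segments of [w].  Orientations vanish on tuples that are not
    orderings of [s], so the coarsening of a cochain is a sum over all tuples
    [w], with coefficients [+-e w] ([coarsenE]).

    In this form the theorem compares two signed sums over the orderings of a
    [(k+1)]-simplex [s].  The boundary of a flag has two kinds of faces.
    - Omitting a vertex other than the origin forgets one proper initial segment
      of [w].  The orderings with the same remaining segments come in pairs that
      differ by an adjacent transposition, hence have opposite signs, and these
      terms cancel ([inner_face_sum_eq0]).
    - Omitting the origin leaves the flag of the ordering [(w_0, ..., w_k)] of
      the facet [s \ w_{k+1}], with origin the center of that facet.  Orderings
      of [s] are the same as pairs of a facet and an ordering of it, so these
      terms are those of the coarse derivative ([d_coarse_coarsenE]).  The signs
      agree because the omitted vertex is the last one of [w], which gives the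
      relative orientation the factor [(-1)^(k+1)], and this is the ratio of the
      signs [(-1)^(k(k+1)/2)] of consecutive degrees ([flag_signS]).

    A simplex with a given origin is a dependent pair.  To reindex sums freely,
    cochains are first extended by zero to arbitrary tuples of vertices
    ([ext_cochain]). *)

Set Implicit Arguments.
Unset Strict Implicit.
Unset Printing Implicit Defensive.

Import GRing.Theory Num.Theory.
Local Open Scope ring_scope.

(** * Initial segments of an ordering *)

Section Prefixes.
Variable V : finType.

Definition prefix_set n (w : n.-tuple V) (m : nat) : {set V} :=
  [set tnth w i | i : 'I_n & (i < m)%N].

Lemma prefix_setP n (w : n.-tuple V) m x :
  reflect (exists2 i : 'I_n, (i < m)%N & x = tnth w i) (x \in prefix_set w m).
Proof.
apply: (iffP imsetP) => -[i]; first by rewrite inE => lt_im ->; exists i.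
by move=> lt_im ->; exists i; rewrite ?inE.
Qed.

Lemma prefix_set_full n (w : n.-tuple V) : prefix_set w n = [set x in w].
Proof.
apply/setP => x; rewrite inE; apply/prefix_setP/tnthP => [[i _ ->]|[i ->]].
  by exists i.
by exists i.
Qed.

Lemma prefix_set0 n (w : n.-tuple V) : prefix_set w 0 = set0.
Proof. by apply/setP => x; rewrite inE; apply/prefix_setP => -[]. Qed.

Lemma prefix_setS n (w : n.-tuple V) m m' :
  (m <= m')%N -> prefix_set w m \subset prefix_set w m'.
Proof.
move=> le_m; apply/subsetP => x /prefix_setP[i lt_i ->].
by apply/prefix_setP; exists i => //; apply: leq_trans le_m.
Qed.

Lemma prefix_set_step n (w : n.-tuple V) (i : 'I_n) : uniq w ->
  prefix_set w i.+1 :\: prefix_set w i = [set tnth w i].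
Proof.
move=> uw; apply/setP => x; rewrite !inE; apply/andP/eqP => [[x'i]|->].
  case/prefix_setP => j; rewrite ltnS leq_eqVlt.
  case/orP => [/eqP/val_inj -> //|lt_ji def_x].
  by case/prefix_setP: x'i; exists j.
split; last by apply/prefix_setP; exists i.
apply/prefix_setP => -[j lt_ji /(tuple_uniqP _ uw) eq_ij].
by rewrite eq_ij ltnn in lt_ji.
Qed.

Lemma prefix_set_proper n (w : n.-tuple V) m m' : uniq w ->
  (m < m')%N -> (m' <= n)%N -> prefix_set w m \proper prefix_set w m'.
Proof.
move=> uw lt_m le_m'n; rewrite properE prefix_setS 1?ltnW //=.
have lt_mn := leq_trans lt_m le_m'n.
have /setP/(_ (tnth w (Ordinal lt_mn))) := prefix_set_step (Ordinal lt_mn) uw.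
rewrite !inE eqxx => /andP[w'm wm]; apply/subsetPn.
exists (tnth w (Ordinal lt_mn)) => //.
by apply: (subsetP (prefix_setS w lt_m)).
Qed.

Lemma prefix_set_perm n (w : n.-tuple V) (p : 'S_n) m :
  (forall i : 'I_n, (p i < m)%N = (i < m)%N) ->
  prefix_set [tuple tnth w (p i) | i < n] m = prefix_set w m.
Proof.
move=> pm; apply/setP => x; apply/prefix_setP/prefix_setP => -[i lt_i ->].
  by exists (p i); rewrite ?pm // tnth_mktuple.
by exists (p^-1%g i); last rewrite tnth_mktuple permKV; rewrite // -pm permKV.
Qed.

Lemma prefix_set_belast n (w : n.+1.-tuple V) m : (m <= n)%N ->
  prefix_set (tdel w ord_max) m = prefix_set w m.
Proof.
move=> le_mn; apply/setP => x; apply/prefix_setP/prefix_setP => -[i lt_i ->].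
  by exists (lift ord_max i); rewrite ?lift_max ?tnth_mktuple.
case: (unliftP ord_max i) lt_i => [j ->|->]; last by rewrite ltnNge le_mn.
by rewrite lift_max => lt_j; exists j; rewrite ?tnth_mktuple.
Qed.

End Prefixes.

(** * The flag of an ordering *)

Section Flag.
Variables (V : finType) (X : scomplex V).

(** The centers [c(tau^{k-1}), ..., c(tau^0)] that follow the origin
    [c(tau^k) = c(s)], where [tau^i = {w_0, ..., w_i}].  The default value
    [center s] makes the flag defined for all [w]; it is taken at no entry when
    [w] is an ordering of [s]. *)
Definition flag k (s : ksimplex X k) (w : k.+1.-tuple V) :
    k.-tuple (simplex X) :=
  [tuple insubd (center s) (prefix_set w (k - i)) | i < k].

Section OneFlag.
Variables (k : nat) (s : ksimplex X k) (w : k.+1.-tuple V).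
Hypothesis ws : [set x in w] = val s.
Let uw : uniq w := ksimplex_ordering_uniq ws.

Lemma prefix_simplex m : (0 < m)%N -> prefix_set w m \in X.
Proof.
move=> m_gt0; apply: (simplex_face (proj1 (andP (valP s)))).
  rewrite -ws; apply/subsetP => x /prefix_setP[i _ ->].
  by rewrite inE mem_tnth.
by apply/set0Pn; exists (tnth w ord0); apply/prefix_setP; exists ord0.
Qed.

Lemma size_flag : size (center s :: flag s w) = k.+1.
Proof. exact: (size_tuple (cons_tuple _ _)). Qed.

Lemma val_flag_nth i : (i <= k)%N ->
  val (nth (center s) (center s :: flag s w) i) = prefix_set w (k.+1 - i).
Proof.
case: i => [_|i lt_ik]; first by rewrite prefix_set_full ws.
have -> : nth (center s) (center s :: flag s w) i.+1
    = tnth (flag s w) (Ordinal lt_ik) by rewrite (tnth_nth (center s)).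
rewrite tnth_mktuple /= subSS.
by rewrite val_insubd prefix_simplex // subn_gt0.
Qed.

Lemma flag_tau : rev [seq val b | b : simplex X <- center s :: flag s w]
  = mkseq (fun i => prefix_set w i.+1) k.+1.
Proof.
have sz := size_flag.
apply: (@eq_from_nth _ set0) => [|i].
  by rewrite size_rev size_map sz size_mkseq.
rewrite size_rev size_map sz => lt_ik; rewrite nth_mkseq // nth_rev size_map sz //.
rewrite (nth_map (center s)) ?sz ?subSS; last by rewrite ltnS leq_subr.
by rewrite val_flag_nth ?leq_subr // subSn ?leq_subr // subKn.
Qed.

(** The initial segments of an ordering form a strictly increasing chain. *)
Lemma flag_osimplex : is_osimplex (sd X) (center s :: flag s w).
Proof.
have defl : center s :: flag s w = mkseq (nth (center s) (center s :: flag s w)) k.+1.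
  rewrite -[LHS](mkseq_nth (center s)); congr mkseq.
  exact: size_flag.
have inl b : b \in center s :: flag s w ->
    exists2 m, (m <= k.+1)%N & val b = prefix_set w m.
  case/(nthP (center s)) => i lt_i <-; exists (k.+1 - i)%N; first exact: leq_subr.
  by rewrite val_flag_nth // -ltnS -size_flag.
apply/andP; split.
  apply/sd_simplicesP; split.
    by apply/set0Pn; exists (center s); rewrite inE mem_head.
  move=> b c; rewrite ![_ \in [set x in _]]inE => /inl[m _ ->] /inl[m' _ ->].
  by case/orP: (leq_total m m') => le_m; rewrite (prefix_setS w le_m) ?orbT.
rewrite defl; apply/(pairwiseP (center s)) => i j.
rewrite !inE size_mkseq => lt_i lt_j lt_ij.
rewrite !nth_mkseq //; apply: proper_card.
rewrite !val_flag_nth //; apply: prefix_set_proper => //; last exact: leq_subr.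
exact: ltn_sub2l.
Qed.

(** Since the members of a flag are nested, each of them is recovered from the
    previous one and the vertex that is added, so the ordering determines the
    flag. *)
Lemma flag_orderingE (t : osimplex (sd X) k (center s)) :
  flag_ordering t w = (val t == flag s w).
Proof.
apply/forallP/eqP => [ft|-> i]; last first.
  rewrite flag_tau -(prefix_set_step _ uw) nth_mkseq //; apply/eqP; congr (_ :\: _).
  case: i => -[|i] lt_ik /=; first by rewrite prefix_set0.
  by rewrite nth_mkseq // ltnW.
set tau := rev _ in ft.
have sz : size tau = k.+1 by rewrite size_rev /= size_map size_tuple.
have chain := sd_chain (valP t).
have sorted_tau : pairwise (fun A B : {set V} => A \subset B) tau.
  have sub_tr : transitive (fun A B : {set V} => A \subset B).
    by move=> B A C; apply: subset_trans.
  have sup_tr : transitive (fun A B : {set V} => B \subset A).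
    by move=> B A C sBA sCB; apply: subset_trans sBA.
  rewrite -(sorted_pairwise sub_tr) rev_sorted (sorted_pairwise sup_tr).
  rewrite pairwise_map.
  have /andP[_] := valP t; apply: sub_in_pairwise (allss _) => b c bl cl lt_cb.
  have [//|sub_bc] := orP (chain c b cl bl).
  by have := subset_leq_card sub_bc; rewrite leqNgt => /negP[]; apply: lt_cb.
have tauE i : (i < k.+1)%N -> nth set0 tau i = prefix_set w i.+1.
  elim: i => [|i IHi] lt_i; have /eqP := ft (Ordinal lt_i).
    by rewrite -(prefix_set_step _ uw) /= prefix_set0 !setD0.
  rewrite -(prefix_set_step _ uw) /= IHi ?(ltnW lt_i) // => eqD.
  rewrite -[LHS](setID _ (prefix_set w i.+1)) eqD -[RHS](setID _ (prefix_set w i.+1)).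
  congr (_ :|: _); rewrite (setIidPr (prefix_setS w (leqnSn _))).
  apply/setIidPr; rewrite -IHi ?(ltnW lt_i) //.
  by apply: (pairwiseP set0 sorted_tau); rewrite ?inE ?sz // ltnW.
have: tau = rev [seq val b | b : simplex X <- center s :: flag s w].
  rewrite flag_tau; apply: (@eq_from_nth _ set0); rewrite sz ?size_mkseq // => i lt_i.
  by rewrite nth_mkseq // tauE.
by move/(can_inj revK)/(inj_map (@val_inj _ _ (simplex X))) => -[] eq_t; apply: val_inj.
Qed.

End OneFlag.
End Flag.

(** * Cochains extended by zero *)

Section Extension.
Variables (K : fieldType) (V : finType) (X : lo_complex V) (E : bundle K X).

Definition ext_cochain k (a : cochain E k) (v0 : V) (t : k.-tuple V) : fib E v0 :=
  if insub t is Some u then a v0 u else 0.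

Lemma ext_cochain_val k (a : cochain E k) v0 (u : osimplex X k v0) :
  ext_cochain a v0 (val u) = a v0 u.
Proof. by rewrite /ext_cochain valK. Qed.

Lemma ext_d_nabla k (a : cochain E k) v0 (t : k.+1.-tuple V) :
  is_osimplex X (v0 :: t) ->
  ext_cochain (d_nabla a) v0 t =
    tr E v0 (thead t) (ext_cochain a (thead t) (behead_tuple t))
      + \sum_(i < k.+1) (-1) ^+ i.+1 *: ext_cochain a v0 (tdel t i).
Proof.
move=> t_simplex; pose u : osimplex X k.+1 v0 := exist _ t t_simplex.
rewrite -[t]/(val u) ext_cochain_val /d_nabla.
rewrite -(ext_cochain_val a (face0 u)); congr (_ + _).
by apply: eq_bigr => i _; rewrite -(ext_cochain_val a (faceS u i)).
Qed.

End Extension.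

(** * Coarsening as a sum over orderings *)

Section Coarsen.

(** The sign of the reversal of [k + 1] entries: a flag is listed downwards from
    its largest member, whereas [w] lists the vertices as they are added. *)
Definition flag_sign (k : nat) : int := (-1) ^+ (k * k.+1)./2.

Lemma flag_signS k : flag_sign k.+1 = flag_sign k * (-1) ^+ k.+1.
Proof.
rewrite /flag_sign -exprD; congr (_ ^+ _).
by rewrite -addn2 mulnDr muln2 halfD odd_double andbF add0n doubleK mulnC.
Qed.

Variables (K : fieldType) (V : finType) (X : scomplex V) (E : bundle K (sd X)).

Lemma osign_eq0 k (s : ksimplex X k) (e : orientation s) w :
  [set x in w] != val s -> e w = 0.
Proof. by rewrite -(osign_neq0 e) negbK => /eqP. Qed.

(** Each flag has a single ordering and each ordering a single flag, so summing
    over either gives the same result. *)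
Lemma coarsenE k (a : cochain E k) (s : ksimplex X k) (e : orientation s) :
  coarsen a s e = \sum_(w : k.+1.-tuple V)
    ext_cochain a (center s) (flag s w) *~ (flag_sign k * e w).
Proof.
rewrite -[LHS]/(coarsen_val a e) /coarsen_val.
have orientE t : flag_orient t e =
    \sum_(w | flag_ordering t w) flag_sign k * e w.
  have [w [_ fw]] := flag_orderingP t.
  rewrite /flag_orient (big_pred1 w) //; case: pickP => [w'|/(_ w)].
    by rewrite fw => /eqP->.
  by rewrite fw eqxx.
under eq_bigr do rewrite orientE mulrz_sumr.
rewrite (exchange_big_dep predT) //=; apply: eq_bigr => w _.
have [ws|/(osign_eq0 e) ->] := eqVneq [set x in w] (val s); last first.
  by rewrite mulr0 mulr0z big1.
pose t : osimplex (sd X) k (center s) := exist _ (flag s w) (flag_osimplex ws).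
rewrite (big_pred1 t) => [|u]; first by rewrite -ext_cochain_val.
by rewrite flag_orderingE.
Qed.

(** * Faces opposite to a vertex other than the origin *)

(** Exchanging positions [k - i] and [k - i + 1] affects only the initial segment
    that ends between them. *)
Lemma swap_prefix k (i : 'I_k.+1) (m : nat) (l : 'I_k.+2) :
  m != (k - i).+1 ->
  (tperm (inord (k - i)) (inord (k - i).+1) l < m)%N = (l < m)%N.
Proof.
move=> neq_m; have le_i : (k - i <= k)%N := leq_subr _ _.
have ltS : ((k - i).+1 < m)%N = (k - i < m)%N by rewrite ltn_neqAle eq_sym neq_m.
by case: tpermP => [->|->|//]; rewrite !inordK ?ltnS ?ltS // ltnW.
Qed.

(** The flag of [w] has at index [i] the initial segment of length
    [k.+1 - i], so exchanging the entries of [w] at positions [k - i] and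
    [k - i + 1] preserves the face that omits it and reverses the sign.  Grouping
    the terms by that face leaves an integer coefficient equal to its opposite;
    it vanishes, whereas in [M] itself, possibly of characteristic 2, being equal
    to its opposite would not suffice. *)
Lemma inner_face_sum_eq0 (M : zmodType) k (s : ksimplex X k.+1) (e : orientation s)
    (i : 'I_k.+1) (F : k.-tuple (simplex X) -> M) :
  \sum_(w : k.+2.-tuple V) F (tdel (flag s w) i) *~ e w = 0.
Proof.
pose p : 'S_k.+2 := tperm (inord (k - i)) (inord (k - i).+1).
pose swap (w : k.+2.-tuple V) := [tuple tnth w (p j) | j < k.+2].
have swapK : involutive swap.
  by move=> w; apply: eq_from_tnth => j; rewrite !tnth_mktuple tpermK.
have face_swap w : tdel (flag s (swap w)) i = tdel (flag s w) i.
  apply: eq_from_tnth => j; rewrite !tnth_mktuple prefix_set_perm // => l.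
  apply: swap_prefix; rewrite -subSn ?leq_ord //.
  have lt_j := ltn_ord (lift i j); have := neq_lift i j.
  apply: contra => /eqP eq_sub; apply/eqP/val_inj.
  by rewrite -[LHS](subKn (ltnW (ltn_ord i))) -eq_sub subKn // ltnW.
have swap_sign w : e (swap w) = - e w.
  rewrite osign_perm odd_tperm -val_eqE /= !inordK ?ltnS ?leq_subr //.
    by rewrite (ltn_eqF (ltnSn _)) mulN1r.
  by rewrite leqW ?leq_subr.
rewrite (partition_big (fun w => tdel (flag s w) i) predT) //= big1 // => T _.
rewrite (eq_bigr (fun w => F T *~ e w)) => [|w /eqP-> //].
rewrite -mulrz_sumr; set S := \sum_(_ | _) _.
have : S = - S.
  rewrite {1}/S (reindex_inj (inv_inj swapK)) -sumrN.
  by apply: eq_big => w; rewrite ?face_swap // => _; apply: swap_sign.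
move/eqP; rewrite -addr_eq0 -mulr2n mulrn_eq0 /= => /eqP->.
by rewrite mulr0z.
Qed.

(** * Faces opposite to the origin *)

Section Facet.
Variables (k : nat) (r : ksimplex X k) (s : ksimplex X k.+1) (w : k.+2.-tuple V).
Hypotheses (ws : [set x in w] = val s) (wr : [set x in tdel w ord_max] = val r).

Lemma thead_flag : thead (flag s w) = center r.
Proof.
apply: val_inj; rewrite /thead tnth_mktuple val_insubd subn0.
by rewrite (prefix_simplex ws) //= -wr -prefix_set_full prefix_set_belast.
Qed.

Lemma behead_flag : behead_tuple (flag s w) = flag r (tdel w ord_max).
Proof.
apply: eq_from_tnth => j; rewrite tnth_behead !tnth_mktuple; apply: val_inj.
have lt_j : (0 < k - j)%N by rewrite subn_gt0.
rewrite (inordK (ltn_ord j : (j.+1 < k.+1)%N)) !val_insubd subSS.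
rewrite (prefix_simplex ws) // (prefix_simplex wr) //.
by rewrite prefix_set_belast // (leq_trans (leq_subr _ _)).
Qed.

End Facet.

(** An ordering of a facet extends in exactly one way, by appending the missing
    vertex, to an ordering of the whole simplex that starts with it. *)
Lemma facet_reindex (M : zmodType) k (r : ksimplex X k) (s : ksimplex X k.+1)
    (F : k.+1.-tuple V -> M) : val r \proper val s ->
  \sum_(u : k.+1.-tuple V | [set x in u] == val r) F u =
  \sum_(w : k.+2.-tuple V | ([set x in w] == val s) &&
     ([set x in tdel w ord_max] == val r)) F (tdel w ord_max).
Proof.
move=> /properP[/subsetP sub_rs [x xs x'r]].
have belast_rcons (u : k.+1.-tuple V) : tdel [tuple of rcons u x] ord_max = u.
  apply: val_inj; rewrite [LHS]tdelE /= -cats1 take_size_cat ?size_tuple //.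
  by rewrite drop_oversize ?cats0 // size_cat size_tuple addn1.
have setU : val s = x |: val r.
  apply/esym/eqP; rewrite eqEcard; apply/andP; split.
    by apply/subsetP => y; rewrite !inE => /predU1P[->|/sub_rs].
  by rewrite cardsU1 x'r (eqP (andP (valP s)).2) (eqP (andP (valP r)).2).
rewrite (reindex_onto (fun w : k.+2.-tuple V => tdel w ord_max)
  (fun u => [tuple of rcons u x])) => [|u _]; last exact: belast_rcons.
apply: eq_bigl => w; rewrite andbC; apply: andb_id2r => /eqP wr.
apply/eqP/eqP => [def_w|ws].
  by apply/setP => y; rewrite inE -{1}def_w mem_rcons setU -wr !inE.
have def_w : rcons (tdel w ord_max) (tnth w ord_max) = w :> seq V.
  rewrite tdelE drop_oversize ?size_tuple // cats0.
  by rewrite (tnth_nth x) -take_nth ?size_tuple // take_oversize ?size_tuple.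
apply: val_inj; rewrite /= -[RHS]def_w; congr rcons.
have : x \in tval w by have /setP/(_ x) := ws; rewrite inE => ->.
rewrite -def_w mem_rcons inE => /predU1P[//|xr].
by case/negP: x'r; rewrite -wr inE.
Qed.

Section CoarseDerivative.
Variables (k : nat) (a : cochain E k).

Definition origin_face_term (s : ksimplex X k.+1) (t : k.+1.-tuple (simplex X)) :
    fib E (center s) :=
  tr E (center s) (thead t) (ext_cochain a (thead t) (behead_tuple t)).

(** Both the relative orientation and the coarsening of the cochain on a facet
    contain the sign of the chosen orientation of that facet; its square is 1, so
    the choice disappears. *)
Lemma d_coarse_coarsenE (ori : forall r : ksimplex X k, orientation r)
    (s : ksimplex X k.+1) (e : orientation s) :
  d_coarse ori (coarsen a) s e =
  \sum_(w : k.+2.-tuple V | [set x in w] == val s)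
    origin_face_term s (flag s w) *~ (flag_sign k.+1 * e w).
Proof.
rewrite /= /d_coarse_val.
transitivity (\sum_(r : ksimplex X k | val r \proper val s)
   \sum_(w : k.+2.-tuple V | ([set x in w] == val s) &&
                             ([set x in tdel w ord_max] == val r))
     origin_face_term s (flag s w) *~ (flag_sign k.+1 * e w)).
  apply: eq_bigr => r lt_rs.
  pose H u := tr E (center s) (center r) (ext_cochain a (center r) (flag r u)).
  transitivity (\sum_(u : k.+1.-tuple V | [set x in u] == val r)
      H u *~ (flag_sign k * ori r u * rel_orient (ori r) e)).
    rewrite coarsenE raddf_sum /= mulrz_suml.
    rewrite [LHS](bigID (fun u => [set x in u] == val r)) /=.
    rewrite addrC big1 ?add0r => [|u /(osign_eq0 (ori r)) ->]; last first.
      by rewrite mulr0 mulr0z raddf0 mul0rz.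
    by apply: eq_bigr => u _; rewrite raddfMz -mulrzA.
  rewrite (facet_reindex _ lt_rs); apply: eq_bigr => w /andP[/eqP ws /eqP wr].
  rewrite /H /origin_face_term (thead_flag ws wr) (behead_flag ws wr); congr (_ *~ _).
  rewrite (rel_orientE _ _ ws wr) flag_signS.
  rewrite -[(-1) ^+ _ * _ * e w]mulrA mulrACA [_ * (_ * e w)]mulrA -expr2.
  by rewrite osign_sqr wr eqxx mul1r.
rewrite (exchange_big_dep (fun w : k.+2.-tuple V => [set x in w] == val s)) /=;
  last by move=> r w _ /andP[].
apply: eq_bigr => w /eqP ws.
have uw := ksimplex_ordering_uniq ws.
(* Only one facet consists of the first k+1 entries of w. *)
have rX : ([set x in tdel w ord_max] \in X)
    && (#|[set x in tdel w ord_max]| == k.+1).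
  rewrite -prefix_set_full prefix_set_belast // (prefix_simplex ws) //=.
  rewrite -(prefix_set_belast w (leqnn k.+1)) prefix_set_full cardsE.
  by rewrite (card_uniqP _) ?size_tuple // (subseq_uniq (tdel_subseq w ord_max)).
pose r0 : ksimplex X k :=
  exist (fun A : {set V} => (A \in X) && (#|A| == k.+1)) _ rX.
rewrite (big_pred1 r0) // => r /=.
rewrite ws eqxx /= [_ == val r]eq_sym.
apply: andb_idl => /eqP->.
rewrite -prefix_set_full prefix_set_belast // -ws -prefix_set_full.
exact: prefix_set_proper.
Qed.

End CoarseDerivative.

End Coarsen.

(** * The coarsening map is a cochain map *)

Theorem proposition7p6 (K : fieldType) (V : finType) (X : scomplex V)
  (E : bundle K (sd X))
  (ori : forall (k : nat) (s : ksimplex X k), orientation s)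
  (k : nat) (a : cochain E k) (s : ksimplex X k.+1) (e : orientation s) :
  d_coarse (ori k) (coarsen a) s e = coarsen (d_nabla a) s e.
Proof.
rewrite d_coarse_coarsenE coarsenE.
transitivity (\sum_(w : k.+2.-tuple V)
   (origin_face_term a s (flag s w) *~ (flag_sign k.+1 * e w) + \sum_(i < k.+1)
     ((-1) ^+ i.+1 *: ext_cochain a (center s) (tdel (flag s w) i)
        *~ flag_sign k.+1) *~ e w)); last first.
  apply: eq_bigr => w _.
  have [ws|/(osign_eq0 e) ->] := eqVneq [set x in w] (val s); last first.
    by rewrite mulr0 !mulr0z big1 ?addr0 // => i _; rewrite mulr0z.
  rewrite (ext_d_nabla _ (flag_osimplex ws)) mulrzDl mulrz_suml.
  by congr (_ + _); apply: eq_bigr => i _; rewrite -mulrzA.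
rewrite big_split /= [X in _ + X]exchange_big /= [X in _ + X]big1 ?addr0 => [|i _].
  rewrite [RHS](bigID (fun w : k.+2.-tuple V => [set x in w] == val s)) /=.
  rewrite [X in _ + X]big1 ?addr0 // => w /(osign_eq0 e) ->.
  by rewrite mulr0 mulr0z.
exact: (inner_face_sum_eq0 e i (fun t =>
  (-1) ^+ i.+1 *: ext_cochain a (center s) t *~ flag_sign k.+1)).
Qed.
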